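(* For every integer $m\geq 4$, every graph with chromatic number at least $m+1$ has a $3$-connected subgraph with chromatic number at least $m$. In particular (since a fragile graph has no 3-connected subgraph), every fragile graph is $4$-colourable.
   Context: All graphs are finite and simple. A graph is $k$-connected if it has at least $k+1$ vertices and no vertex cutset with at most $k-1$ vertices. A graph is fragile if it has no $3$-connected subgraph. *)

(* Defs.v *)
From mathcomp Require Import all_boot.
Set Implicit Arguments. Unset Strict Implicit. Unset Printing Implicit Defensive.

Section Graphs.
Variable T : finType.

Definition simple_graph (e : rel T) : Prop := symmetric e /\ irreflexive e.

Definition subgraph (e : rel T) (V : {set T}) (E : rel T) : Prop :=
  symmetric E /\ forall x y, E x y -> [&& e x y, x \in V & y \in V].

Definition connected_on (V : {set T}) (E : rel T) : Prop :=
  forall x y, x \in V -> y \in V ->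
    connect [rel a b | [&& E a b, a \in V & b \in V]] x y.

Definition k_connected (k : nat) (V : {set T}) (E : rel T) : Prop :=
  k.+1 <= #|V| /\
  forall S : {set T}, S \subset V -> #|S| <= k.-1 -> connected_on (V :\: S) E.

Definition colourable (V : {set T}) (E : rel T) (c : nat) : Prop :=
  exists f : T -> nat,
    (forall x, x \in V -> f x < c) /\
    (forall x y, x \in V -> y \in V -> E x y -> f x != f y).

Definition chi_ge (V : {set T}) (E : rel T) (m : nat) : Prop :=
  forall c, colourable V E c -> m <= c.

Definition fragile (e : rel T) : Prop :=
  ~ exists (V : {set T}) (E : rel T), subgraph e V E /\ k_connected 3 V E.

End Graphs.

(* Main.v *)
(* Fix n >= 3 such that every 3-connected subgraph is n-colourable.  By induction
   on |V|, the induced subgraph on V has (n+1)-colourings that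
     (1) give x and y the same colour, if x and y are non-adjacent;
     (2) give x a colour different from those of v and w, if x is not v or w;
     (3) use exactly two colours on {p, r, s}, if these are distinct and r, s
         are non-adjacent.
   If V has at most 3 vertices or is 3-connected, take an n-colouring and give the
   spare colour to a suitable stable set.  Otherwise split V along a 2-separation
   {p, q} and glue colourings of the two sides after permuting colours; the
   colourings supplied by (1)-(3) on the sides always include a compatible pair.
   (2) excludes sides forcing the colour of x into {p, q}, and (3) excludes sides
   forcing x, p, q to be all equal or all distinct. *)

Require Import Defs.
From mathcomp Require Import all_boot.
From mathcomp Require Import fingroup perm.
From Stdlib Require Import Classical.

Set Implicit Arguments.
Unset Strict Implicit.
Unset Printing Implicit Defensive.

(** * Permutations of colours with prescribed values *)

Lemma perm_extend3 (C : finType) (a b : 'I_3 -> C) :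
  (forall i j, (a i == a j) = (b i == b j)) ->
  exists s : {perm C}, forall i, s (a i) = b i.
Proof.
move=> ab.
have key m (m3 : m <= 3) :
    exists s : {perm C}, forall i : 'I_3, i < m -> s (a i) = b i.
  elim: m m3 => [|m IH] m3; first by exists 1%g.
  have [s Hs] := IH (ltnW m3); pose i0 := Ordinal m3.
  (* The transposition corrects the value at the new index. Earlier values survive because [a] and
     [b] have the same equality pattern, so an earlier [b i] is moved only if [a i = a i0]. *)
  exists (s * tperm (s (a i0)) (b i0))%g => i.
  rewrite permM ltnS leq_eqVlt => /orP [/eqP im|im].
    by rewrite (_ : i = i0) ?tpermL //; apply: val_inj.
  case: (eqVneq (a i) (a i0)) => [aE|aN].
    by rewrite aE tpermL; apply/eqP; rewrite eq_sym -ab aE.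
  rewrite tpermD ?(inj_eq perm_inj) 1?eq_sym // Hs //.
  by rewrite -ab.
by have [s Hs] := key 3 (leqnn 3); exists s => i; apply: Hs.
Qed.

Lemma perm_extend (C : finType) (a1 a2 a3 b1 b2 b3 : C) :
  (a1 == a2) = (b1 == b2) -> (a1 == a3) = (b1 == b3) ->
  (a2 == a3) = (b2 == b3) ->
  exists s : {perm C}, [/\ s a1 = b1, s a2 = b2 & s a3 = b3].
Proof.
move=> h12 h13 h23.
have [|s Hs] := @perm_extend3 C (tnth [tuple a1; a2; a3])
  (tnth [tuple b1; b2; b3]); last first.
  exists s; split; [exact: (Hs (@Ordinal 3 0 isT))|
    exact: (Hs (@Ordinal 3 1 isT))|exact: (Hs (@Ordinal 3 2 isT))].
by case=> [[|[|[|i]]] // Hi] [[|[|[|j]]] // Hj];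
   rewrite /tnth /= ?eqxx // eq_sym ?h12 ?h13 ?h23 eq_sym.
Qed.

Lemma exists_notin (C : finType) (s : seq C) :
  size s < #|C| -> exists z, z \notin s.
Proof.
move=> lt_s; apply/existsP; rewrite -negb_forall; apply/negP => /forallP all_s.
suff : #|C| <= size s by rewrite leqNgt lt_s.
rewrite cardT; apply: uniq_leq_size (enum_uniq _) _ => z _.
exact: all_s.
Qed.

Ltac colours :=
  repeat match goal with
  | H : is_true (_ != _) |- _ => move/eqP: H => H
  | H : is_true (_ == _) |- _ => move/eqP: H => H
  end;
  match goal with
  | |- (_ == _) = (_ == _) => apply/eqP/eqP; congruence
  | |- is_true (_ != _) => apply/eqP; congruence
  | |- _ => congruence
  end.

(** * Colourings with a spare colour, and the three flexibility conditions *)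

Section Colourings.

Variables (T : finType) (e : rel T) (n : nat).
Hypotheses (e_sym : symmetric e) (e_irr : irreflexive e).
Hypothesis n_ge3 : 3 <= n.

Local Notation colour := 'I_n.+1.

Definition proper_col (V : {set T}) (f : T -> colour) :=
  forall x y, x \in V -> y \in V -> e x y -> f x != f y.

(** An [n]-colouring encoded with [n.+1] colours, so that the missing colour [ord_max] can be handed
    out afterwards. *)
Definition spare_col (V : {set T}) :=
  exists f, proper_col V f /\ forall x, x \in V -> f x != ord_max.

Definition can_agree (V : {set T}) := forall x y,
  x \in V -> y \in V -> ~~ e x y -> exists2 f, proper_col V f & f x = f y.

(** The case [v = w] is allowed; it serves to give two chosen vertices different colours. *)
Definition can_avoid (V : {set T}) := forall x v w,
  x \in V -> v \in V -> w \in V -> x != v -> x != w ->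
  exists f, [/\ proper_col V f, f x != f v & f x != f w].

(** The disjuncts are ordered by the odd one out: [a], then [c], then [b]. Later case analyses
    follow this order. *)
Definition two_coloured (a b c : colour) :=
  [|| (a != b) && (b == c), (a == b) && (b != c) | (a == c) && (b != c)].

Definition can_two_colour (V : {set T}) := forall p r s,
  p \in V -> r \in V -> s \in V -> p != r -> p != s -> r != s -> ~~ e r s ->
  exists2 f, proper_col V f & two_coloured (f p) (f r) (f s).

Definition flexible V := [/\ can_agree V, can_avoid V & can_two_colour V].

Lemma recolour (V S : {set T}) (f : T -> colour) :
    proper_col V f -> (forall x, x \in V -> f x != ord_max) ->
    (forall x y, x \in S -> y \in S -> ~~ e x y) ->
  proper_col V (fun x => if x \in S then ord_max else f x).
Proof.
move=> fP fN stS x y xV yV exy.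
case: ifP => xS; case: ifP => yS.
- by move: (stS x y xS yS); rewrite exy.
- by rewrite eq_sym fN.
- by rewrite fN.
- exact: fP.
Qed.

Lemma two_coloured_swap12 a b c : two_coloured a b c = two_coloured b a c.
Proof.
have [-> //|ab] := eqVneq a b.
rewrite /two_coloured (eq_sym b a) (negPf ab).
by case: (b == c); case: (a == c).
Qed.

Lemma two_coloured_swap23 a b c : two_coloured a b c = two_coloured a c b.
Proof.
have [-> //|bc] := eqVneq b c.
rewrite /two_coloured (eq_sym c b) (negPf bc) !andbF !andbT.
by rewrite /= orbC.
Qed.

(** The spare colour goes to the stable sets [{x, y}], [{x}] and [{r, s}] respectively; in the last
    case [p] keeps an ordinary colour. *)
Lemma spare_flexible V : spare_col V -> flexible V.
Proof.
case=> f [fP fN]; split.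
- move=> x y xV yV exy.
  have st a b : a \in [set x; y] -> b \in [set x; y] -> ~~ e a b.
    by case/set2P=> ->; case/set2P=> ->; rewrite ?e_irr // e_sym.
  exists (fun z => if z \in [set x; y] then ord_max else f z).
    exact: recolour.
  by rewrite set21 set22.
- move=> x v w xV vV wV xv xw.
  have st a b : a \in [set x] -> b \in [set x] -> ~~ e a b.
    by move=> /set1P -> /set1P ->; rewrite e_irr.
  exists (fun z => if z \in [set x] then ord_max else f z).
  rewrite !inE eqxx ![_ == x]eq_sym (negPf xv) (negPf xw).
  by split; [exact: recolour|rewrite eq_sym fN..].
move=> p r s pV rV sV pr ps rs ers.
have st a b : a \in [set r; s] -> b \in [set r; s] -> ~~ e a b.
  by case/set2P=> ->; case/set2P=> ->; rewrite ?e_irr // e_sym.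
exists (fun z => if z \in [set r; s] then ord_max else f z).
  exact: recolour.
by rewrite set21 set22 !inE (negPf pr) (negPf ps) /two_coloured eqxx fN.
Qed.

(** * Separations of order two, and gluing along them *)

Record separation (V A B : {set T}) (p q : T) : Prop := Separation {
  sepU : A :|: B = V;
  sepI : A :&: B = [set p; q];
  sep_neq : p != q;
  sepE : forall a b, a \in A :\: B -> b \in B :\: A -> ~~ e a b }.

Lemma separationC V A B p q : separation V A B p q -> separation V B A p q.
Proof.
case=> sU sI npq sE; split; [by rewrite setUC|by rewrite setIC|by []|].
by move=> a b aB bA; rewrite e_sym sE.
Qed.

Lemma separation_swap V A B p q : separation V A B p q -> separation V A B q p.
Proof.
by case=> sU sI npq sE; split=> //; [rewrite sI setUC | rewrite eq_sym].
Qed.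

Lemma sep_mem V A B p q : separation V A B p q ->
  [/\ p \in A, q \in A, p \in B & q \in B].
Proof.
case=> _ sI _ _.
have: p \in A :&: B by rewrite sI set21.
have: q \in A :&: B by rewrite sI set22.
by rewrite !inE => /andP[-> ->] /andP[-> ->].
Qed.

(** The three equations say that [g] on [p, q, y] has the equality pattern of [f p, f q, z], so a
    permutation of the colours of [g] realises these values. Prescribing [z] controls one vertex on
    the far side as well as the cut. *)
Lemma glue V A B p q (f g : T -> colour) y z :
    separation V A B p q -> proper_col A f -> proper_col B g -> y \in B ->
    (g p == g q) = (f p == f q) -> (g p == g y) = (f p == z) ->
    (g q == g y) = (f q == z) ->
  exists h, [/\ proper_col V h, forall a, a \in A -> h a = f a & h y = z].
Proof.
move=> S fP gP yB pq py qy; have [pA qA pB qB] := sep_mem S.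
have [s [sp sq sy]] := perm_extend pq py qy.
case: S => sU sI npq sE.
have onI x : x \in A -> x \in B -> s (g x) = f x.
  move=> xA xB; have: x \in A :&: B by rewrite inE xA.
  by rewrite sI => /set2P [] ->.
exists (fun x => if x \in A then f x else s (g x)); split.
- move=> x y' ; rewrite -sU !inE => xV yV exy.
  have sgP a b : a \in B -> b \in B -> e a b -> s (g a) != s (g b).
    by move=> aB bB eab; rewrite (inj_eq perm_inj); apply: gP.
  case: ifP => xA; case: ifP => yA.
  + exact: fP.
  + rewrite yA /= in yV; case: (boolP (x \in B)) => xB.
      by rewrite -onI // sgP.
    by have := sE x y'; rewrite !inE xA yA yV xB exy => /(_ isT isT).
  + rewrite xA /= in xV; case: (boolP (y' \in B)) => yB'.
      by rewrite -onI // sgP.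
    by have := sE y' x; rewrite !inE xA yA xV yB' e_sym exy => /(_ isT isT).
  + by rewrite xA yA /= in xV yV; apply: sgP.
- by move=> a ->.
- by case: ifP => yA //; rewrite -onI.
Qed.

Arguments glue {V A B p q f g} y z.

(** Since [3 <= n], there are at least four colours. *)
Lemma fresh (a b c : colour) : exists z, [/\ z != a, z != b & z != c].
Proof.
have [|z] := @exists_notin colour [:: a; b; c]; first by rewrite card_ord.
by rewrite !inE !negb_or => /and3P [? ? ?]; exists z.
Qed.

(** * Combining flexible sides across a 2-separation *)

Section Separated.

Variables (V A B : {set T}) (p q : T).
Hypotheses (S : separation V A B p q) (flA : flexible A) (flB : flexible B).

Lemma extend_col f : proper_col A f ->
  exists2 h, proper_col V h & forall a, a \in A -> h a = f a.
Proof.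
move=> fP; have [pA qA pB qB] := sep_mem S.
have [agB avB _] := flB.
have [g [gP pq]] : exists g, proper_col B g /\ (g p == g q) = (f p == f q).
  case: (boolP (f p == f q)) => fpq.
    have [|g gP gpq] := agB p q pB qB; last by exists g; rewrite gpq eqxx.
    by apply: contraTN fpq => epq; apply: fP.
  have [g [gP gpq _]] := avB p q q pB qB qB (sep_neq S) (sep_neq S).
  by exists g; rewrite (negPf gpq).
(* No vertex beyond the cut needs control, so [p] itself fills the third slot. *)
have [||h [hP hA _]] := glue p (f p) S fP gP pB pq; first by rewrite !eqxx.
  by rewrite eq_sym pq eq_sym.
by exists h.
Qed.

(** First try a colouring [d] of [B] with [y] and [z] alike and keep [x] off their colour. If the
    patterns on the cut make this impossible, the two sides offer enough other patterns to make [x]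
    match exactly one of [y], [z]. *)
Lemma two_coloured_lone (x y z : T) :
    x \in A :\: B -> y \in B -> z \in B -> ~~ e y z -> y != z ->
  exists2 f, proper_col V f & two_coloured (f x) (f y) (f z).
Proof.
move=> xAB yB zB eyz yz.
have /andP [xB xA] : (x \notin B) && (x \in A) by move: xAB; rewrite inE.
have [agA avA twA] := flA; have [agB avB twB] := flB.
have done_with r s c f g : separation V A B r s -> proper_col A f ->
    proper_col B g -> (f r == f s) = (g r == g s) ->
    (f r == f x) = (g r == c) -> (f s == f x) = (g s == c) ->
    two_coloured c (g y) (g z) ->
    exists2 h, proper_col V h & two_coloured (h x) (h y) (h z).
  move=> S' fP gP rs rx sx tw.
  have [h [hP hB hx]] := glue x c (separationC S') gP fP xA rs rx sx.
  by exists h => //; rewrite hx !hB.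
have [d dP dyz] := agB y z yB zB eyz.
have free c : c != d y -> two_coloured c (d y) (d z).
  by move=> cN; rewrite /two_coloured -dyz eqxx cN.
have nx r : r \in B -> r != x by move=> rB; apply: contraNneq xB => <-.
have [dpq|dpq] := eqVneq (d p) (d q); last first.
  (* Some cut vertex [r] is not coloured like [y]. On [A], let the other cut vertex [s] avoid [r]
     and [x]: then [x] can take either the colour of [r] or a fresh one. *)
  have key r s : separation V A B r s -> d r != d s -> d y != d r ->
      exists2 h, proper_col V h & two_coloured (h x) (h y) (h z).
    move=> S' drs dyr; have [rA sA rB sB] := sep_mem S'.
    have [|c [cP csr csx]] := avA s r x sA rA xA _ (nx s sB).
      by rewrite eq_sym (sep_neq S').
    have [crx|crx] := eqVneq (c r) (c x).
      by apply: (done_with r s (d r) c d) => //; [colours..|apply: free; colours].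
    have [t [tr ts ty]] := fresh (d r) (d s) (d y).
    by apply: (done_with r s t c d) => //; [colours..|apply: free; colours].
  have [dyp|dyp] := eqVneq (d y) (d p); last exact: (key p q).
  by apply: (key q p) => //; [exact: separation_swap|colours..].
have [pA qA pB qB] := sep_mem S.
have pq : p != q := sep_neq S.
have xp : x != p by rewrite eq_sym nx.
have xq : x != q by rewrite eq_sym nx.
have epq : ~~ e p q.
  by apply: contra_eqN dpq => epq; apply: dP.
have all_eq c : proper_col A c -> c p = c q -> c x != c p ->
    exists2 h, proper_col V h & two_coloured (h x) (h y) (h z).
  move=> cP cpq cxp; have [t [tp _ ty]] := fresh (d p) (d p) (d y).
  by apply: (done_with p q t c d) => //; [colours..|apply: free; colours].
have [c [cP cxp cxq]] := avA x p q xA pA qA xp xq.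
have [cpq|cpq] := eqVneq (c p) (c q); first exact: (all_eq c).
have [d' [d'P d'pq _]] := avB p q q pB qB qB pq pq.
have [c' c'P tw] := twA x p q xA pA qA xp xq pq epq.
(* Through [c'] the vertex [x] can receive [d' r], and through [c] any colour other than [d' r] and
   [d' s]. If [d'] separates [y] and [z], at least one of their colours differs from [d' s] and is
   thus available to [x]; otherwise a fresh colour works. *)
have key r s : separation V A B r s -> c r != c s -> c x != c r -> c x != c s ->
    d' r != d' s -> c' x = c' r -> c' r != c' s ->
    exists2 h, proper_col V h & two_coloured (h x) (h y) (h z).
  move=> S' crs cxr cxs d'rs c'xr c'rs.
  have [d'yz|d'yz] := eqVneq (d' y) (d' z).
    have [t [tr ts ty]] := fresh (d' r) (d' s) (d' y).
    apply: (done_with r s t c d') => //; [colours..|].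
    by rewrite /two_coloured -d'yz eqxx ty.
  have [d'ry|d'ry] := eqVneq (d' r) (d' y).
    apply: (done_with r s (d' r) c' d') => //; [colours..|].
    by rewrite /two_coloured d'ry eqxx d'yz orbT.
  have [d'rz|d'rz] := eqVneq (d' r) (d' z).
    apply: (done_with r s (d' r) c' d') => //; [colours..|].
    by rewrite /two_coloured d'rz eqxx d'yz !orbT.
  have [d'ys|d'ys] := eqVneq (d' y) (d' s).
    apply: (done_with r s (d' z) c d') => //; [colours..|].
    by rewrite /two_coloured eqxx d'yz !orbT.
  apply: (done_with r s (d' y) c d') => //; [colours..|].
  by rewrite /two_coloured eqxx d'yz !orbT.
case/or3P: tw => /andP [t1 t2].
- by apply: (all_eq c') => //; apply/eqP.
- by apply: (key p q) => //; apply/eqP.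
- by apply: (key q p) => //; [exact: separation_swap|colours..].
Qed.

(* If one side has p = q and the other p <> q, then [can_two_colour] on the side
   with p <> q and [can_avoid] centred at p or q on the other supply a match. *)
Lemma agree_across x y : x \in A :\: B -> y \in B :\: A ->
  exists2 f, proper_col V f & f x = f y.
Proof.
move=> xAB yBA; have pq : p != q := sep_neq S.
have key (A' B' : {set T}) a b f g : separation V A' B' p q ->
    flexible A' -> flexible B' -> a \in A' :\: B' -> b \in B' :\: A' ->
    proper_col A' f -> proper_col B' g -> f p = f q -> f a != f p ->
    g p != g q -> g b != g p -> g b != g q ->
    exists2 h, proper_col V h & h a = h b.
  move=> S' [agA avA _] [_ _ twB]; rewrite !inE => /andP [aB aA] /andP [bA bB].
  move=> fP gP fpq fap gpq gbp gbq; have [pA qA pB qB] := sep_mem S'.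
  have na r : r \in B' -> r != a by move=> rB; apply: contraNneq aB => <-.
  have nb r : r \in A' -> b != r by move=> rA; apply: contraNneq bA => ->.
  have done_with f' g' : proper_col A' f' -> proper_col B' g' ->
      (g' p == g' q) = (f' p == f' q) -> (g' p == g' b) = (f' p == f' a) ->
      (g' q == g' b) = (f' q == f' a) -> exists2 h, proper_col V h & h a = h b.
    move=> f'P g'P e1 e2 e3; have [h [hP hA hb]] := glue b (f' a) S' f'P g'P bB e1 e2 e3.
    by exists h; rewrite // hA.
  have epq : ~~ e p q by apply: contra_eqN fpq => epq; apply: fP.
  have to_q r s : r \in A' -> s \in A' -> r \in B' -> s \in B' -> r != s ->
      (g r != g s) -> g b != g r -> g b != g s ->
      (forall f' g' : T -> colour, proper_col A' f' -> proper_col B' g' ->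
        (g' r == g' s) = (f' r == f' s) -> (g' r == g' b) = (f' r == f' a) ->
        (g' s == g' b) = (f' s == f' a) ->
        exists2 h, proper_col V h & h a = h b) ->
      forall g', proper_col B' g' -> g' b = g' r -> g' r != g' s ->
      exists2 h, proper_col V h & h a = h b.
    move=> rA sA rB sB rs grs gbr gbs dw g' g'P g'br g'rs.
    (* With [s] avoiding [r] and [a], either [a] is coloured like [r], which matches [g'] at [b], or
       [a, r, s] are all distinct, which matches [g]. *)
    have [|f' [f'P f'sr f'sa]] := avA s r a sA rA aA _ (na s sB).
      by rewrite eq_sym.
    have [f'ar|f'ar] := eqVneq (f' a) (f' r).
      by apply: (dw f' g') => //; colours.
    by apply: (dw f' g) => //; colours.
  have [g' g'P tw] := twB b p q bB pB qB (nb p pA) (nb q qA) pq epq.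
  case/or3P: tw => /andP [t1 t2].
  - by apply: (done_with f g') => //; colours.
  - by apply: (to_q p q _ _ _ _ _ _ _ _ _ g') => //; apply/eqP.
  - apply: (to_q q p _ _ _ _ _ _ _ _ _ g') => //; try colours.
    by move=> f1 g1 f1P g1P E ? ?; apply: (done_with f1 g1); rewrite // eq_sym E eq_sym.
have /andP [xB xA] : (x \notin B) && (x \in A) by move: xAB; rewrite inE.
have /andP [yA yB] : (y \notin A) && (y \in B) by move: yBA; rewrite inE.
have [pA qA pB qB] := sep_mem S.
have [_ avA _] := flA; have [_ avB _] := flB.
have nx r : r \in B -> x != r by move=> rB; apply: contraNneq xB => ->.
have ny r : r \in A -> y != r by move=> rA; apply: contraNneq yA => ->.
have [f [fP fxp fxq]] := avA x p q xA pA qA (nx p pB) (nx q qB).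
have [g [gP gyp gyq]] := avB y p q yB pB qB (ny p pA) (ny q qA).
(* Both [x] and [y] avoid the colours of the cut on their own sides, so the patterns match unless
   just one side colours [p] and [q] alike. *)
have [fpq|fpq] := eqVneq (f p) (f q); have [gpq|gpq] := eqVneq (g p) (g q).
- have [|||h [hP hA hy]] := glue y (f x) S fP gP yB; try colours.
  by exists h; rewrite // hA.
- exact: (key A B x y f g).
- suff [h hP hyx] : exists2 h, proper_col V h & h y = h x by exists h.
  exact: (key B A y x g f (separationC S)).
- have [|||h [hP hA hy]] := glue y (f x) S fP gP yB; try colours.
  by exists h; rewrite // hA.
Qed.

(** Letting [p] avoid [q] too on each side makes the patterns on the cut agree. Gluing then keeps
    [p] and [w] apart, because it only permutes the colours of [g]. *)
Lemma avoid_cut v w : v \in A -> w \in B -> p != v -> p != w ->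
  exists f, [/\ proper_col V f, f p != f v & f p != f w].
Proof.
move=> vA wB pv pw; have pq : p != q := sep_neq S.
have [pA qA pB qB] := sep_mem S; have [_ avA _] := flA; have [_ avB _] := flB.
have [f [fP fpv fpq]] := avA p v q pA vA qA pv pq.
have [g [gP gpw gpq]] := avB p w q pB wB qB pw pq.
have done_with t : t != f p -> (g q == g w) = (f q == t) ->
    exists h, [/\ proper_col V h, h p != h v & h p != h w].
  move=> tp qt; have [||h [hP hA hw]] := glue w t S fP gP wB _ _ qt; try colours.
  by exists h; rewrite hw !hA //; split=> //; rewrite eq_sym.
have [gqw|gqw] := eqVneq (g q) (g w); first by apply: (done_with (f q)); colours.
have [t [tp tq _]] := fresh (f p) (f q) (f q).
by apply: (done_with t) => //; colours.
Qed.

(** Let [x] avoid [p] as well as [v]. Then [w] may safely take the colour of [p] or one new to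
    [p, q, x]; only the colour of [q] is dangerous, so [q] is made to avoid [w] when [p] and [q]
    differ. *)
Lemma avoid_split x v w : x \in A :\: B -> v \in A -> w \in B :\: A -> x != v ->
  exists f, [/\ proper_col V f, f x != f v & f x != f w].
Proof.
rewrite !inE => /andP [xB xA] vA /andP [wA wB] xv.
have [pA qA pB qB] := sep_mem S; have pq : p != q := sep_neq S.
have [_ avA _] := flA; have [agB avB _] := flB.
have nx r : r \in B -> x != r by move=> rB; apply: contraNneq xB => ->.
have nw r : r \in A -> r != w by move=> rA; apply: contraNneq wA => <-.
have done_with t f g : proper_col A f -> proper_col B g -> f x != f v ->
    t != f x -> (g p == g q) = (f p == f q) -> (g p == g w) = (f p == t) ->
    (g q == g w) = (f q == t) ->
    exists h, [/\ proper_col V h, h x != h v & h x != h w].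
  move=> fP gP fxv tx gpq gpw gqw.
  have [h [hP hA hw]] := glue w t S fP gP wB gpq gpw gqw.
  by exists h; rewrite hw !hA //; split=> //; rewrite eq_sym.
have [f [fP fxv fxp]] := avA x v p xA vA pA xv (nx p pB).
have [t [tp tq tx]] := fresh (f p) (f q) (f x).
have [fpq|fpq] := eqVneq (f p) (f q).
  have [|g gP gpq] := agB p q pB qB.
    by apply: contra_eqN fpq => epq; apply: fP.
  have [gpw|gpw] := eqVneq (g p) (g w).
    by apply: (done_with (f p) f g) => //; colours.
  by apply: (done_with t f g) => //; colours.
have qp : q != p by rewrite eq_sym.
have [g [gP gqp gqw]] := avB q p w qB pB wB qp (nw q qA).
have [gpw|gpw] := eqVneq (g p) (g w).
  by apply: (done_with (f p) f g) => //; colours.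
by apply: (done_with t f g) => //; colours.
Qed.

End Separated.

(** * Cliques, small sets, and the existence of 2-separations *)

Lemma card_clique_spare (W : {set T}) :
  (forall x y, x \in W -> y \in W -> x != y -> e x y) -> spare_col W ->
  #|W| <= n.
Proof.
move=> clW [f [fP fN]].
have f_inj : {in W &, injective f}.
  move=> x y xW yW; apply: contra_eq => xy.
  by apply: fP => //; apply: clW.
rewrite -(card_in_imset f_inj).
apply: (@leq_trans #|[set~ (ord_max : colour)]|); last first.
  by rewrite cardsC1 card_ord.
apply/subset_leq_card/subsetP => c /imsetP [x xW ->].
by rewrite !inE fN.
Qed.

Lemma k_connected_clique (k : nat) (W : {set T}) :
  (forall x y, x \in W -> y \in W -> x != y -> e x y) -> k < #|W| ->
  k_connected k W e.
Proof.
move=> clW kW; split=> // S _ _ x y xW yW.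
have [->|xy] := eqVneq x y; first exact: connect0.
apply: connect1; rewrite /= xW yW !andbT.
by move: xW yW; rewrite !inE => /andP [_ xW] /andP [_ yW]; apply: clW.
Qed.

Lemma spare_small (V : {set T}) : #|V| <= 3 -> spare_col V.
Proof.
move=> V3; exists (fun x => inord (index x (enum V))).
have lt_n x : x \in V -> index x (enum V) < n.
  move=> xV; apply: leq_trans n_ge3; apply: leq_trans V3.
  by rewrite cardE index_mem mem_enum.
have valE x : x \in V -> (inord (index x (enum V)) : colour) = index x (enum V) :> nat.
  by move=> xV; rewrite inordK //; apply: leqW; exact: lt_n.
split=> [x y xV yV exy|x xV]; apply/eqP => /(congr1 (@nat_of_ord _)).
  rewrite /= !valE // => /(index_inj _) xy.
  by move: exy; rewrite xy ?mem_enum ?e_irr.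
by rewrite /= valE // => E; move: (lt_n x xV); rewrite E ltnn.
Qed.

(** The order [#|A :&: B|] is left free, so that small cutsets can be enlarged, while both
    differences must be non-empty, which later makes both sides proper. *)
Definition weak_separation (V A B : {set T}) :=
  [/\ A :|: B = V, A :\: B != set0, B :\: A != set0 &
      forall a b, a \in A :\: B -> b \in B :\: A -> ~~ e a b].

Lemma weak_separationC V A B : weak_separation V A B -> weak_separation V B A.
Proof.
case=> U nA nB E; split=> //; first by rewrite setUC.
by move=> a b aB bA; rewrite e_sym E.
Qed.

(** Adding a vertex of [A :\: B] to [B] puts it in the cut; a second vertex keeps the difference
    non-empty. *)
Lemma weak_separation_grow V A B :
    weak_separation V A B -> 1 < #|A :\: B| ->
  exists A' B', weak_separation V A' B' /\ #|A' :&: B'| = #|A :&: B|.+1.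
Proof.
case=> U nA nB E cA; have [v vAB] := set0Pn _ nA.
have /andP [vB vA] : (v \notin B) && (v \in A) by move: vAB; rewrite inE.
have DA : A :\: (v |: B) = (A :\: B) :\ v.
  by apply/setP => z; rewrite !inE negb_or andbA.
have DB : (v |: B) :\: A = B :\: A.
  by apply/setP => z; rewrite !inE; case: eqP => // ->; rewrite vA.
exists A, (v |: B); split.
  split; rewrite ?DA ?DB //.
  - by rewrite setUCA U; apply/setUidPr; rewrite sub1set -U inE vA.
  - by rewrite -card_gt0 -(ltn_add2l 1) addn0; move: cA; rewrite (cardsD1 v) vAB.
  - by move=> a b; rewrite !inE => /andP [_ aAB] bBA; apply: E; rewrite inE.
by rewrite setIUr (_ : A :&: [set v] = [set v]) ?cardsU1 ?inE ?(negPf vB) ?andbF //;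
   apply/setIidPr; rewrite sub1set.
Qed.

Lemma separation_exists (V : {set T}) : 3 < #|V| -> ~ k_connected 3 V e ->
  exists A B p q, [/\ separation V A B p q, A \proper V & B \proper V].
Proof.
move=> V4 nconn.
have [A [B [W AB2]]] : exists A B, weak_separation V A B /\ #|A :&: B| <= 2.
  apply: NNPP => none; apply: nconn; split=> // S SV S2 x y xV yV.
  set R := [rel a b | _]; case: (boolP (connect R x y)) => // nxy.
  (* [X] is the component of [x] after deleting the cutset [S]; the sides are [X :|: S] and
     [V :\: X], meeting in [S]. *)
  case: none; pose X := [set z in V :\: S | connect R x z].
  have XV z : z \in X -> z \in V by rewrite !inE => /andP [/andP []].
  have XS z : z \in X -> z \notin S by rewrite !inE => /andP [/andP []].
  have SVz z : z \in S -> z \in V by apply: (subsetP SV).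
  have sep1 : (X :|: S) :\: (V :\: X) = X.
    apply/setP => z; rewrite in_setD in_setD in_setU negb_and negbK.
    have [zX|zX] //= := boolP (z \in X).
    by have [zS|zS] := boolP (z \in S); rewrite /= ?andbF // SVz.
  have sep2 : (V :\: X) :\: (X :|: S) = V :\: S :\: X.
    by rewrite setDDl setUA setUid setDDl (setUC S).
  have sepI : (X :|: S) :&: (V :\: X) = S.
    apply/setP => z; rewrite in_setI in_setD in_setU.
    have [zX|zX] /= := boolP (z \in X).
      by rewrite (negPf (XS z zX)).
    by have [zS|zS] := boolP (z \in S); rewrite /= ?andbF // SVz.
  exists (X :|: S), (V :\: X); rewrite sepI; split=> //; split.
  - apply/setP => z; rewrite in_setU in_setU in_setD.
    have [zX|zX] /= := boolP (z \in X); first by rewrite XV.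
    by have [zS|zS] := boolP (z \in S); rewrite //= SVz.
  - by rewrite sep1; apply/set0Pn; exists x; rewrite inE xV connect0.
  - by rewrite sep2; apply/set0Pn; exists y; rewrite inE yV inE yV andbT.
  move=> a b; rewrite sep1 sep2 [a \in X]inE => /andP [aV xa] /setDP [bV bX].
  apply: contra bX => eab; rewrite inE bV; apply: connect_trans xa _.
  by apply: connect1; rewrite /= eab aV bV.
have [C [D [{}W CD]]] :
    exists C D, weak_separation V C D /\ #|C :&: D| = 2.
  have cardV C D : weak_separation V C D ->
      #|V| = #|C :&: D| + #|C :\: D| + #|D :\: C|.
    case=> <- _ _ _; rewrite cardsU -(cardsID D C) -(cardsID C D) (setIC D C).
    by rewrite addnCA addKn.
  have grow C D : weak_separation V C D -> #|C :&: D| <= 1 ->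
      exists C' D', weak_separation V C' D' /\ #|C' :&: D'| = #|C :&: D|.+1.
    move=> W' CD1; have cV := cardV _ _ W'.
    (* If neither difference had two vertices, a cut of at most one vertex would leave [V] with at
       most three. *)
    have [CD|CD] := ltnP 1 #|C :\: D|; first exact: weak_separation_grow.
    have [DC|DC] := ltnP 1 #|D :\: C|.
      rewrite setIC; apply: weak_separation_grow DC.
      exact: weak_separationC.
    move: V4; rewrite cV ltnNge => /negP [].
    exact: (leq_add (leq_add CD1 CD) DC).
  case E: #|A :&: B| AB2 => [|[|[|//]]] _; last by exists A, B.
    have [||C [D [W' E']]] := grow A B; rewrite ?E //.
    have [||C' [D' [W'' E'']]] := grow C D; rewrite ?E' ?E //.
    by exists C', D'; rewrite E'' E' E.
  have [||C [D [W' E']]] := grow A B; rewrite ?E //.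
  by exists C, D; rewrite E' E.
have /cards2P [p [q [pq pqE]]] : #|C :&: D| == 2 by rewrite CD.
case: W => U nC nD E; exists C, D, p, q; split=> //.
- rewrite -U properE subsetUl subUset subxx /=.
  by rewrite -setD_eq0.
- rewrite -U properE subsetUr subUset subxx andbT.
  by rewrite -setD_eq0.
Qed.

(** * Using the 3-connected sets to complete the induction *)

Hypothesis spare : forall W : {set T}, k_connected 3 W e -> spare_col W.

Section Separated.

Variables (V A B : {set T}) (p q : T).
Hypotheses (S : separation V A B p q) (flA : flexible A) (flB : flexible B).

(** The colour of [x] must avoid two vertices across the cut, and possibly [p] and [q] too, so four
    colours may not suffice. This is the one gluing case that appeals to [spare]. *)
Lemma avoid_opposite x v w : x \in A :\: B -> v \in B -> w \in B ->
  exists f, [/\ proper_col V f, f x != f v & f x != f w].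
Proof.
rewrite inE => /andP [xB xA] vB wB.
have [pA qA pB qB] := sep_mem S; have pq : p != q := sep_neq S.
have [_ avA twA] := flA; have [agB avB _] := flB.
have nx r : r \in B -> x != r by move=> rB; apply: contraNneq xB => ->.
have done_with t f g : proper_col A f -> proper_col B g ->
    t != g v -> t != g w -> (f p == f q) = (g p == g q) ->
    (f p == f x) = (g p == t) -> (f q == f x) = (g q == t) ->
    exists h, [/\ proper_col V h, h x != h v & h x != h w].
  move=> fP gP tv tw fpq fpx fqx.
  have [h [hP hB hx]] := glue x t (separationC S) gP fP xA fpq fpx fqx.
  by exists h; rewrite hx !hB.
have [f [fP fxp fxq]] := avA x p q xA pA qA (nx p pB) (nx q qB).
have [epq|epq] := boolP (e p q).
  have fpq := fP p q pA qA epq.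
  (* A colour is left over on B unless p, q, v, w form a K_4; being 3-connected,
     that clique is n-colourable, so that n >= 4 and a fifth colour exists. *)
  pose W := [set a in [:: p; q; v; w]].
  have WB a : a \in W -> a \in B.
    by rewrite !inE => /or4P [] /eqP ->.
  have [g gP ltgW] : exists2 g, proper_col B g & #|g @: W| < #|{: colour}|.
    suff [g gP gW] : exists2 g, proper_col B g & #|g @: W| <= n.
      by exists g; rewrite // card_ord.
    have [clW|] := boolP [forall a in W, forall b in W, (a != b) ==> e a b].
      have [g gP _] := agB p p pB pB (negbT (e_irr p)).
      exists g => //; apply: leq_trans (leq_imset_card _ _) _.
      have {}clW a b : a \in W -> b \in W -> a != b -> e a b.
        by move=> aW bW; move: (implyP (forall_inP (forall_inP clW a aW) b bW)).
      have [W3|W4] := leqP #|W| 3; first exact: leq_trans W3 n_ge3.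
      by apply: card_clique_spare => //; apply/spare/k_connected_clique.
    move/forall_inPn=> [a aW /forall_inPn [b bW]]; rewrite negb_imply => /andP [ab eab].
    have [g gP gab] := agB a b (WB a aW) (WB b bW) eab.
    exists g => //; rewrite -ltnS; apply: (@leq_trans #|W|).
      rewrite ltn_neqAle leq_imset_card andbT; apply/imset_injP => /(_ a b aW bW gab).
      exact/eqP.
    apply: (@leq_trans 4) => //.
    by rewrite cardsE; apply: card_size.
  have /existsP [t tW] : [exists t, t \notin g @: W].
    rewrite -negb_forall; apply: contraL ltgW => /forallP all_t.
    by rewrite -leqNgt; apply/subset_leq_card/subsetP => t _.
  have tN a : a \in W -> t != g a.
    by move=> aW; apply: contraNneq tW => ->; apply: imset_f.
  have [tp tq tv tw] : [/\ t != g p, t != g q, t != g v & t != g w].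
    by split; apply: tN; rewrite !inE eqxx ?orbT.
  have gpq := gP p q pB qB epq.
  by apply: (done_with t f g) => //; colours.
have [fpq|fpq] := eqVneq (f p) (f q).
  have [g gP gpq] := agB p q pB qB epq.
  have [t [tp tv tw]] := fresh (g p) (g v) (g w).
  by apply: (done_with t f g) => //; colours.
have [f2 f2P tw2] := twA x p q xA pA qA (nx p pB) (nx q qB) pq epq.
have [g [gP gpq _]] := avB p q q pB qB qB pq pq.
(* If a cut vertex shares its colour with [v] or [w], only three colours need avoiding and [f] works
   with a fresh one. Otherwise the colours of [p] and [q] are both safe for [x], and [f2] decides
   which is used or reduces to [p] and [q] coloured alike. *)
have [gpv|gpv] := eqVneq (g p) (g v).
  have [t [tq tv tw]] := fresh (g q) (g v) (g w).
  by apply: (done_with t f g) => //; colours.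
have [gpw|gpw] := eqVneq (g p) (g w).
  have [t [tq tv tw]] := fresh (g q) (g v) (g w).
  by apply: (done_with t f g) => //; colours.
have [gqv|gqv] := eqVneq (g q) (g v).
  have [t [tq tv tw]] := fresh (g p) (g v) (g w).
  by apply: (done_with t f g) => //; colours.
have [gqw|gqw] := eqVneq (g q) (g w).
  have [t [tq tv tw]] := fresh (g p) (g v) (g w).
  by apply: (done_with t f g) => //; colours.
case/or3P: tw2 => /andP [t1 t2].
- have [g' g'P g'pq] := agB p q pB qB epq.
  have [t [tp tv tw]] := fresh (g' p) (g' v) (g' w).
  by apply: (done_with t f2 g') => //; colours.
- by apply: (done_with (g p) f2 g) => //; colours.
- by apply: (done_with (g q) f2 g) => //; colours.
Qed.

End Separated.

Lemma separation_flexible V A B p q :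
  separation V A B p q -> flexible A -> flexible B -> flexible V.
Proof.
move=> S flA flB; have SC := separationC S.
have extA := extend_col S flB; have extB := extend_col SC flA.
have [agA avA twA] := flA; have [agB avB twB] := flB.
have inV x : x \in V -> x \in A /\ x \in B \/ x \in A :\: B \/ x \in B :\: A.
  by rewrite -(sepU S) !inE; case: (x \in A); case: (x \in B); auto.
have DA x : x \in A :\: B -> x \in A by case/setDP.
have DB x : x \in B :\: A -> x \in B by case/setDP.
have agV : can_agree V.
  have inA x y : x \in A -> y \in A -> ~~ e x y ->
      exists2 f, proper_col V f & f x = f y.
    move=> xA yA exy; have [f fP fxy] := agA x y xA yA exy.
    by have [h hP hE] := extA f fP; exists h; rewrite ?hE.
  have inB x y : x \in B -> y \in B -> ~~ e x y ->
      exists2 f, proper_col V f & f x = f y.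
    move=> xB yB exy; have [f fP fxy] := agB x y xB yB exy.
    by have [h hP hE] := extB f fP; exists h; rewrite ?hE.
  move=> x y /inV [[xA xB]|[xAB|xBA]] /inV [[yA yB]|[yAB|yBA]] exy; auto.
  + exact: (agree_across S flA flB).
  + exact: (agree_across SC flB flA).
have avV : can_avoid V.
  have inA x v w : x \in A -> v \in A -> w \in A -> x != v -> x != w ->
      exists f, [/\ proper_col V f, f x != f v & f x != f w].
    move=> xA vA wA xv xw; have [f [fP fxv fxw]] := avA x v w xA vA wA xv xw.
    by have [h hP hE] := extA f fP; exists h; rewrite !hE.
  have inB x v w : x \in B -> v \in B -> w \in B -> x != v -> x != w ->
      exists f, [/\ proper_col V f, f x != f v & f x != f w].
    move=> xB vB wB xv xw; have [f [fP fxv fxw]] := avB x v w xB vB wB xv xw.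
    by have [h hP hE] := extB f fP; exists h; rewrite !hE.
  have sym x v w : (exists f, [/\ proper_col V f, f x != f v & f x != f w]) ->
      exists f, [/\ proper_col V f, f x != f w & f x != f v].
    by case=> f [? ? ?]; exists f.
  have cut x v w : x \in A -> x \in B -> v \in A -> w \in B -> x != v -> x != w ->
      exists f, [/\ proper_col V f, f x != f v & f x != f w].
    move=> xA xB vA wB xv xw.
    have /set2P [E|E] : x \in [set p; q] by rewrite -(sepI S) inE xA.
      by rewrite E in xv xw *; apply: (avoid_cut S).
    by rewrite E in xv xw *; apply: (avoid_cut (separation_swap S)).
  have splitA x v w := @avoid_split _ _ _ _ _ S flA flB x v w.
  have splitB x v w := @avoid_split _ _ _ _ _ SC flB flA x v w.
  have oppA x v w := @avoid_opposite _ _ _ _ _ S flA flB x v w.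
  have oppB x v w := @avoid_opposite _ _ _ _ _ SC flB flA x v w.
  (* Up to exchanging [v] and [w] or the two sides: all three share a side, [x] is in the cut
     between [v] and [w], or [x] is off the cut with [v, w] split or both opposite. *)
  move=> x v w /inV [[xA xB]|[xAB|xBA]] /inV [[vA vB]|[vAB|vBA]]
    /inV [[wA wB]|[wAB|wBA]] xv xw; auto 7.
split=> //.
pose Q x y z := exists2 f, proper_col V f & two_coloured (f x) (f y) (f z).
have Q12 x y z : Q x y z -> Q y x z.
  by case=> f fP tw; exists f; rewrite // two_coloured_swap12.
have Q23 x y z : Q x y z -> Q x z y.
  by case=> f fP tw; exists f; rewrite // two_coloured_swap23.
move=> x y z xV yV zV xy xz yz eyz; rewrite -/(Q x y z).
have inA : x \in A -> y \in A -> z \in A -> Q x y z.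
  move=> xA yA zA; have [f fP fxy] := twA x y z xA yA zA xy xz yz eyz.
  by have [h hP hE] := extA f fP; exists h; rewrite ?hE.
have inB : x \in B -> y \in B -> z \in B -> Q x y z.
  move=> xB yB zB; have [f fP fxy] := twB x y z xB yB zB xy xz yz eyz.
  by have [h hP hE] := extB f fP; exists h; rewrite ?hE.
(* If [x] is adjacent to [y] or [z], colouring [y] and [z] alike suffices. Otherwise the three
   vertices are pairwise non-adjacent and play symmetric roles, so any of them may be the lone
   one. *)
have adj : e x y || e x z -> Q x y z.
  move=> exyz; have [f fP fyz] := agV y z yV zV eyz.
  exists f; rewrite // /two_coloured -fyz eqxx andbT.
  by case/orP: exyz => [/fP -> //|/fP]; rewrite fyz => ->.
have [/adj //|] := boolP (e x y || e x z); rewrite negb_or => /andP [exy exz].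
have loneA a b c := @two_coloured_lone _ _ _ _ _ S flA flB a b c.
have loneB a b c := @two_coloured_lone _ _ _ _ _ SC flB flA a b c.
have xA : x \in A :\: B -> y \in B -> z \in B -> Q x y z by move=> *; apply: loneA.
have xB : x \in B :\: A -> y \in A -> z \in A -> Q x y z by move=> *; apply: loneB.
have yA : y \in A :\: B -> x \in B -> z \in B -> Q x y z.
  by move=> *; apply/Q12/loneA.
have yB : y \in B :\: A -> x \in A -> z \in A -> Q x y z.
  by move=> *; apply/Q12/loneB.
have zA : z \in A :\: B -> x \in B -> y \in B -> Q x y z.
  by move=> *; apply/Q23/Q12/loneA.
have zB : z \in B :\: A -> x \in A -> y \in A -> Q x y z.
  by move=> *; apply/Q23/Q12/loneB.
by case/inV: xV => [[? ?]|[?|?]]; case/inV: yV => [[? ?]|[?|?]];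
   case/inV: zV => [[? ?]|[?|?]]; auto.
Qed.

Lemma all_flexible (V : {set T}) : flexible V.
Proof.
have [N] := ubnP #|V|; elim: N V => // N IH V; rewrite ltnS => VN.
have [V3|V4] := leqP #|V| 3; first exact/spare_flexible/spare_small.
have [conn|nconn] := classic (k_connected 3 V e).
  exact/spare_flexible/spare.
have [A [B [p [q [S AV BV]]]]] := separation_exists V4 nconn.
by apply: (separation_flexible S); apply: IH; apply: leq_trans VN; apply: proper_card.
Qed.

Lemma exists_proper_col : exists f, proper_col [set: T] f.
Proof.
have [x _|T0] := pickP [pred x : T | true]; last first.
  by exists (fun _ => ord0) => x; have := T0 x.
have [agT _ _] := all_flexible [set: T].
(* A vertex is non-adjacent to itself, so agreement of [x] with [x] yields a plain proper
   colouring. *)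
have [f fP _] := agT x x (in_setT x) (in_setT x) (negbT (e_irr x)).
by exists f.
Qed.

End Colourings.

(** * From the ambient relation to subgraphs, and the theorem *)

Lemma k_connected_restrict (T : finType) (e : rel T) k (V : {set T}) :
  k_connected k V e -> k_connected k V [rel x y | [&& e x y, x \in V & y \in V]].
Proof.
case=> kV conn; split=> // S SV Sk x y xV yV.
have := conn S SV Sk x y xV yV; apply: connect_sub => a b /and3P [eab aV bV].
by apply: connect1; rewrite /= eab aV bV !andbT;
   move: aV bV; rewrite !inE => /andP [_ ->] /andP [_ ->].
Qed.

(** Common source of both claims. Only induced subgraphs are tested, with edges cut down to [W]
    because [subgraph] requires edges to stay inside the vertex set. *)
Lemma colourable_of_3connected (T : finType) (e : rel T) (n : nat) :
    3 <= n -> simple_graph e ->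
    (forall (V : {set T}) (E : rel T),
       subgraph e V E -> k_connected 3 V E -> colourable V E n) ->
  colourable [set: T] e n.+1.
Proof.
move=> n3 [e_sym e_irr] col3.
have spare (W : {set T}) : k_connected 3 W e -> spare_col e n W.
  move=> /k_connected_restrict Wconn.
  have [|f [fn fP]] := col3 _ _ _ Wconn.
    by split=> // x y /=; rewrite e_sym (andbC (x \in W)).
  exists (fun x => inord (f x)).
  have fE x : x \in W -> (inord (f x) : 'I_n.+1) = f x :> nat.
    by move=> xW; rewrite inordK //; apply: leqW; apply: fn.
  split=> [x y xW yW exy|x xW]; rewrite -val_eqE /= !fE //.
    by apply: fP; rewrite //= exy xW.
  by rewrite ltn_eqF // fn.
have [f fP] := exists_proper_col e_sym e_irr n3 spare.
exists (fun x => f x); split=> [x _|x y xT yT exy]; first exact: ltn_ord.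
exact: fP.
Qed.

Theorem theorem2 :
  (forall (m : nat) (T : finType) (e : rel T),
     4 <= m -> simple_graph e -> chi_ge [set: T] e m.+1 ->
     exists (V : {set T}) (E : rel T),
       [/\ subgraph e V E, k_connected 3 V E & chi_ge V E m]) /\
  (forall (T : finType) (e : rel T),
     simple_graph e -> fragile e -> colourable [set: T] e 4).
Proof.
split=> [m T e m4 eG chi|T e eG frag]; last first.
  (* Here [n = 3], and fragility makes the colouring condition vacuous. *)
  by apply: colourable_of_3connected => // V E sub conn; case: frag; exists V, E.
apply: NNPP => none.
have : colourable [set: T] e m.
  (* With [m = n.+1], a 3-connected subgraph that is not [n]-colourable has chromatic number at
     least [m]. *)
  case: m m4 {chi} none => // n n3 none.
  apply: colourable_of_3connected => // V E sub conn.
  apply: NNPP => ncol; apply: none; exists V, E; split=> // c [f [fc fP]].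
  rewrite leqNgt; apply/negP => cn; apply: ncol; exists f; split=> // x xV.
  exact: leq_trans (fc x xV) cn.
by move/chi; rewrite ltnn.
Qed.
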